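(* Let $\mathbb{F}$ be an algebraically closed field (of arbitrary characteristic), let $\Gamma$ be a group generated by a finite ordered set $(\gamma_1,\ldots,\gamma_n)$, and let $\rho,\sigma\in \mathrm{Hom}(\Gamma,\mathrm{SL}_2(\mathbb{F}))$. Then the following four statements are equivalent: 1. $\tau_\rho=\tau_\sigma$; 2. $\tau_\rho$ and $\tau_\sigma$ agree on all ordered products of distinct generators, i.e. on all $\gamma_{j_1}\gamma_{j_2}\cdots\gamma_{j_m}$ with $1\le j_1<\cdots<j_m\le n$, $1\le m\le n$; 3. $\tau_\rho$ and $\tau_\sigma$ agree on all ordered single, double and triple products of distinct generators, i.e. on all $\gamma_{j_1}\cdots\gamma_{j_m}$ with $1\le j_1<\cdots<j_m\le n$, $1\le m\le 3$; 4. $\rho$ and $\sigma$ are closure-equivalent.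
   Context: For a representation $\rho\colon\Gamma\to\mathrm{SL}_2(\mathbb{F})$, its character is $\tau_\rho\colon\Gamma\to\mathbb{F}$, $\tau_\rho(\gamma)=\mathrm{tr}(\rho(\gamma))$. The set $R(\Gamma,\mathbb{F})=\mathrm{Hom}(\Gamma,\mathrm{SL}_2(\mathbb{F}))$ is an affine algebraic subset of $\mathrm{SL}_2(\mathbb{F})^n\subset\mathbb{F}^{4n}$ via $\rho\mapsto(\rho(\gamma_1),\ldots,\rho(\gamma_n))$ and carries the Zariski topology; $\mathrm{SL}_2(\mathbb{F})$ acts on it by conjugation. Two representations are closure-equivalent if the Zariski closures of their conjugation orbits intersect. *)

(* Defs.v *)
From HB Require Import structures.
From mathcomp Require Import all_boot all_order all_algebra.
From mathcomp Require Import mpoly.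

Set Implicit Arguments.
Unset Strict Implicit.
Unset Printing Implicit Defensive.

Import GRing.Theory.
Local Open Scope ring_scope.

Record sl2 (F : fieldType) := SL2 {
  sl2_mx :> 'M[F]_2;
  _ : \det sl2_mx == 1
}.

HB.instance Definition _ (F : fieldType) := [isSub for @sl2_mx F].
HB.instance Definition _ (F : fieldType) := [Choice of sl2 F by <:].

Section SL2Group.
Variable F : fieldType.
Implicit Types A B C : sl2 F.

Lemma det_sl2 A : \det A = 1.
Proof. exact/eqP/(valP A). Qed.

Lemma sl2_unit A : (A : 'M_2) \in unitmx.
Proof. by rewrite unitmxE det_sl2 unitr1. Qed.

Fact sl2_one_subproof : \det (1%:M : 'M[F]_2) == 1.
Proof. by rewrite det1. Qed.

Fact sl2_mul_subproof A B : \det (A *m B) == 1.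
Proof. by rewrite det_mulmx !det_sl2 mulr1. Qed.

Fact sl2_inv_subproof A : \det (invmx A) == 1.
Proof. by rewrite det_inv det_sl2 invr1. Qed.

Definition sl2_one : sl2 F := SL2 sl2_one_subproof.
Definition sl2_mul A B : sl2 F := SL2 (sl2_mul_subproof A B).
Definition sl2_inv A : sl2 F := SL2 (sl2_inv_subproof A).

Fact sl2_mulA : associative sl2_mul.
Proof. by move=> A B C; apply/val_inj/mulmxA. Qed.

Fact sl2_mul1 : left_id sl2_one sl2_mul.
Proof. by move=> A; apply/val_inj/mul1mx. Qed.

Fact sl2_mul1r : right_id sl2_one sl2_mul.
Proof. by move=> A; apply/val_inj/mulmx1. Qed.

Fact sl2_mulV : left_inverse sl2_one sl2_inv sl2_mul.
Proof. by move=> A; apply/val_inj/mulVmx/sl2_unit. Qed.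

Fact sl2_mulVr : right_inverse sl2_one sl2_inv sl2_mul.
Proof. by move=> A; apply/val_inj/mulmxV/sl2_unit. Qed.

HB.instance Definition _ :=
  isGroup.Build (sl2 F) sl2_mulA sl2_mul1 sl2_mul1r sl2_mulV sl2_mulVr.

End SL2Group.

Notation "''Hom_SL2' ( G , F )" := {multiplicative G -> sl2 F}
  (at level 8, format "''Hom_SL2' ( G ,  F )") : type_scope.

(* H ranges over the subgroups of G containing the gam i. *)
Definition generates (G : groupType) (n : nat) (gam : 'I_n -> G) : Prop :=
  forall H : G -> Prop,
    H 1%g -> (forall x y, H x -> H y -> H (x / y)%g) ->
    (forall i, H (gam i)) -> forall x, H x.

Section Representations.
Variables (F : fieldType) (G : groupType).
Implicit Types rho sigma chi : 'Hom_SL2(G, F).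

Definition rep_char rho (x : G) : F := \tr (rho x).

Variables (n : nat) (gam : 'I_n -> G).

Definition increasing (m : nat) (j : 'I_m -> 'I_n) : Prop :=
  forall a b : 'I_m, (a < b)%N -> (j a < j b)%N.

Definition ordered_prod (m : nat) (j : 'I_m -> 'I_n) : G :=
  (\prod_(k < m) gam (j k))%g.

(* Monotonicity of j forces m <= n, so l = n covers all ordered products of
   distinct generators, and l = 3 the single, double and triple ones. *)
Definition agree_upto (l : nat) rho sigma : Prop :=
  forall (m : nat) (j : 'I_m -> 'I_n), (1 <= m <= l)%N -> increasing j ->
    rep_char rho (ordered_prod j) = rep_char sigma (ordered_prod j).

(* The point (rho gam_1, ..., rho gam_n) of the affine space F ^ (4 n),
   with the entries of the matrices listed row by row. *)
Definition rep_coord rho : 'I_(n * (2 * 2)) -> F :=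
  fun k => mxvec (\matrix_(i < n) mxvec (rho (gam i) : 'M[F]_2)) 0 k.

(* The topology on Hom(G, SL_2(F)) is induced by rep_coord from the Zariski
   topology of F ^ (4 n); I is a possibly infinite family of equations. *)
Definition zariski_closed (Z : 'Hom_SL2(G, F) -> Prop) : Prop :=
  exists I : {mpoly F[n * (2 * 2)]} -> Prop,
    forall chi, Z chi <-> (forall p, I p -> p.@[rep_coord chi] = 0).

Definition zariski_closure (A : 'Hom_SL2(G, F) -> Prop) chi : Prop :=
  forall Z : 'Hom_SL2(G, F) -> Prop, zariski_closed Z ->
    (forall psi, A psi -> Z psi) -> Z chi.

Definition conj_orbit rho chi : Prop :=
  exists g : sl2 F, forall x : G, chi x = (g * rho x * g^-1)%g.

Definition closure_equiv rho sigma : Prop :=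
  exists chi, zariski_closure (conj_orbit rho) chi /\
              zariski_closure (conj_orbit sigma) chi.

End Representations.

(* Main.v *)
From HB Require Import structures.
Require Import Defs.
From mathcomp Require Import all_boot all_order all_algebra.
From mathcomp Require Import mpoly ring.

(** Closure-equivalent representations have the same character because every
trace function is a conjugation-invariant polynomial in the matrices of the
generators ([entries_poly], [char_closure]). The substance is that agreement on
single, double and triple products implies closure-equivalence. Write A i and
B i for the images of the generators under rho and sigma.

First, the trace of A i A j A k is then known for all indices, ordered or not,
since exchanging two factors only brings in shorter products ([triple_traces]).

Suppose that the A i have no common eigenvector. Then there are X = A i and Y =
A j or Y = A j + A k with [X, Y] invertible ([common_triangular]). For such a
pair I, X, Y, XY is a basis of the 2 x 2 matrices. The pair (X, Y) has a normal
form, in the basis v, vY with v an eigenvector of X, that depends only on traces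
and determinants ([pair_normal_form]); so it is conjugate to the corresponding
pair (X', Y') on the side of sigma. The trace form being nondegenerate, each A l
is determined by the traces of A l, A l X, A l Y and A l X Y, which involve at
most three generators; hence the same g conjugates A l to B l
([conjugate_of_traces]), and rho and sigma are conjugate. The case where the B i
have no common eigenvector is symmetric.

Suppose finally that both families are triangularizable. Conjugating by
diag(t, 1/t) and letting t tend to 0 puts the diagonal parts in the closures of
the orbits ([triangular_degeneration]). Traces of single and double products
determine the pairs of diagonal entries up to one global exchange
([diagonals_match]), so the two closures have a diagonal representation in
common ([closure_equiv_triangular]). *)

Set Implicit Arguments.
Unset Strict Implicit.
Unset Printing Implicit Defensive.

Import GRing.Theory.
Local Open Scope ring_scope.

(** * Trace identities for 2 x 2 matrices *)

Section Matrices2.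
Variable R : comNzRingType.
Implicit Types A B X Y Z : 'M[R]_2.

Lemma mulmx2E A B i j : (A *m B) i j = A i 0 * B 0 j + A i 1 * B 1 j.
Proof.
rewrite mxE !big_ord_recl big_ord0 addr0; congr (_ + A i _ * B _ j);
  exact/val_inj.
Qed.

Lemma mxtrace2E A : \tr A = A 0 0 + A 1 1.
Proof.
rewrite /mxtrace !big_ord_recl big_ord0 addr0; congr (_ + A _ _);
  exact/val_inj.
Qed.

Lemma det2E A : \det A = A 0 0 * A 1 1 - A 0 1 * A 1 0.
Proof.
rewrite (expand_det_row _ 0) !big_ord_recl big_ord0 addr0 /cofactor !det_mx11.
rewrite !mxE /= expr0 expr1 mul1r mulN1r mulrN.
by congr (_ * A _ _ - A _ _ * A _ _); apply/val_inj.
Qed.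

Lemma mx2P A B :
  A 0 0 = B 0 0 -> A 0 1 = B 0 1 -> A 1 0 = B 1 0 -> A 1 1 = B 1 1 -> A = B.
Proof.
move=> e00 e01 e10 e11.
have ordP (i : 'I_2) : i = 0 \/ i = 1.
  by case: i => [[|[|//]] lti]; [left | right]; apply/val_inj.
by apply/matrixP=> i j; case: (ordP i) => ->; case: (ordP j) => ->.
Qed.

Lemma rV2P (u v : 'rV[R]_2) : u 0 0 = v 0 0 -> u 0 1 = v 0 1 -> u = v.
Proof.
move=> e0 e1; apply/rowP=> -[[|[|//]] lti].
  by rewrite (_ : Ordinal lti = 0) //; apply: val_inj.
by rewrite (_ : Ordinal lti = 1) //; apply: val_inj.
Qed.

Definition mx2 (a b c d : R) : 'M[R]_2 :=
  \matrix_(i, j) if i == 0 then if j == 0 then a else b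
                 else if j == 0 then c else d.

Lemma mx2E a b c d :
  ((mx2 a b c d 0 0 = a) * (mx2 a b c d 0 1 = b) *
  (mx2 a b c d 1 0 = c) * (mx2 a b c d 1 1 = d))%type.
Proof. by rewrite !mxE. Qed.

Definition lie_mx X Y : 'M[R]_2 := X *m Y - Y *m X.

Lemma add2E A B i j : (A + B) i j = A i j + B i j. Proof. by rewrite mxE. Qed.
Lemma sub2E A B i j : (A - B) i j = A i j - B i j. Proof. by rewrite !mxE. Qed.
Lemma scale2E a A i j : (a *: A) i j = a * A i j. Proof. by rewrite mxE. Qed.
Definition mx2_simp :=
  (mxtrace2E, det2E, sub2E, add2E, scale2E, mulmx2E, mx2E).

(** For determinant 1 the right-hand side is 2 minus the trace of the group
commutator, so its vanishing is Fricke's criterion for a pair to have a common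
eigenvector. Its point here is that it only involves traces and determinants:
non-vanishing passes from a pair to any pair with the same traces. *)
Lemma det_lie_mxE X Y :
  \det (lie_mx X Y) =
  4 * \det X * \det Y + \tr X * \tr Y * \tr (X *m Y) -
  \tr X ^+ 2 * \det Y - \tr Y ^+ 2 * \det X - \tr (X *m Y) ^+ 2.
Proof. rewrite /lie_mx !mx2_simp; ring. Qed.

Lemma tr_sq A : \tr (A *m A) = \tr A ^+ 2 - 2 * \det A.
Proof. rewrite !mx2_simp; ring. Qed.

Lemma det_add A B :
  \det (A + B) = \det A + \det B + \tr A * \tr B - \tr (A *m B).
Proof. rewrite !mx2_simp; ring. Qed.

(** Up to traces of shorter products, the trace of a triple product is an
alternating function of its factors; no division by 2 occurs. *)
Lemma tr_swap A B C : \tr (B *m A *m C) = - \tr (A *m B *m C) +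
   \tr A * \tr (B *m C) + \tr B * \tr (A *m C) + \tr C * \tr (A *m B) -
   \tr A * \tr B * \tr C.
Proof. rewrite !mx2_simp; ring. Qed.

(** Polarization of Cayley-Hamilton. Together these two identities make I, X, Y
and XY span the algebra generated by X and Y. *)
Lemma anticommutator A B : A *m B + B *m A =
  \tr A *: B + \tr B *: A + (\tr (A *m B) - \tr A * \tr B) *: 1%:M.
Proof. by apply: mx2P; rewrite !mx2_simp !mxE /= ?mulr1n ?mulr0n; ring. Qed.

Lemma Cayley_Hamilton2 A : A *m A = \tr A *: A - \det A *: 1%:M.
Proof. by apply: mx2P; rewrite !mx2_simp !mxE /= ?mulr1n ?mulr0n; ring. Qed.

Lemma tr_dup A C : \tr (A *m A *m C) = \tr A * \tr (A *m C) - \det A * \tr C.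
Proof. rewrite !mx2_simp; ring. Qed.
End Matrices2.

Section TraceForm.
Variable F : fieldType.

(** The hypothesis makes I, X, Y, XY a basis of the 2 x 2 matrices, and the
trace form is nondegenerate. Concretely the four equations form a linear system
in the entries of D; after D11 = - D00 it is a 3 x 3 system whose determinant
is exactly that of [lie_mx X Y], and it is solved by Cramer's rule. *)
Lemma trace_form_nondegenerate (X Y D : 'M[F]_2) :
  \det (lie_mx X Y) != 0 -> \tr D = 0 -> \tr (D *m X) = 0 ->
  \tr (D *m Y) = 0 -> \tr (D *m (X *m Y)) = 0 -> D = 0.
Proof.
move=> dXY t1 tX tY tXY.
have cancel e : \det (lie_mx X Y) * e = 0 -> e = 0.
  by move/eqP; rewrite mulf_eq0 (negPf dXY) => /eqP.
have D11 : D 1 1 = - D 0 0.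
  by apply/eqP; rewrite -addr_eq0 addrC -mxtrace2E t1.
pose m1 : F := (X *m Y) 0 0 - (X *m Y) 1 1.
pose m2 : F := (X *m Y) 1 0; pose m3 : F := (X *m Y) 0 1.
pose x1 : F := X 0 0 - X 1 1; pose x2 : F := X 1 0; pose x3 : F := X 0 1.
pose y1 : F := Y 0 0 - Y 1 1; pose y2 : F := Y 1 0; pose y3 : F := Y 0 1.
(* The vectors x, y, m are the coefficient rows of the system; the factors
   multiplying the traces are their 2 x 2 minors. *)
have D00 : D 0 0 = 0.
  apply: cancel; transitivity (\tr (D *m X) * (y2 * m3 - y3 * m2)
    - \tr (D *m Y) * (x2 * m3 - x3 * m2)
    + \tr (D *m (X *m Y)) * (x2 * y3 - x3 * y2)); last first.
    by rewrite tX tY tXY; ring.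
  rewrite /m1 /m2 /m3 /x1 /x2 /x3 /y1 /y2 /y3 /lie_mx !mx2_simp D11; ring.
have D01 : D 0 1 = 0.
  apply: cancel; transitivity (\tr (D *m Y) * (x1 * m3 - x3 * m1)
    - \tr (D *m X) * (y1 * m3 - y3 * m1)
    - \tr (D *m (X *m Y)) * (x1 * y3 - x3 * y1)); last first.
    by rewrite tX tY tXY; ring.
  rewrite /m1 /m2 /m3 /x1 /x2 /x3 /y1 /y2 /y3 /lie_mx !mx2_simp D11; ring.
have D10 : D 1 0 = 0.
  apply: cancel; transitivity (\tr (D *m X) * (y1 * m2 - y2 * m1)
    - \tr (D *m Y) * (x1 * m2 - x2 * m1)
    + \tr (D *m (X *m Y)) * (x1 * y2 - x2 * y1)); last first.
    by rewrite tX tY tXY; ring.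
  rewrite /m1 /m2 /m3 /x1 /x2 /x3 /y1 /y2 /y3 /lie_mx !mx2_simp D11; ring.
by apply: mx2P; rewrite ?D11 ?D00 ?D01 ?D10 !mxE ?oppr0.
Qed.
End TraceForm.

(** * Pairs without a common eigenvector *)

Section NormalForm.
Variable F : closedFieldType.
Implicit Types (X Y Z : 'M[F]_2).

Lemma root_quadratic (p q : F) : exists z, z ^+ 2 = p * z + q.
Proof.
have [z ez] := @GRing.solve_monicpoly F 2 (nth 0 [:: q; p]) isT.
by exists z; rewrite ez !big_ord_recl big_ord0 /= expr0 expr1; ring.
Qed.

Lemma left_eigenvector X (a : F) : a ^+ 2 = \tr X * a - \det X ->
  exists2 v : 'rV_2, v != 0 & v *m X = a *: v.
Proof.
move=> ea.
have /eqP/det0P [v nv ev] : \det (X - a%:M) = 0.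
  move: ea; rewrite !mx2_simp !mxE /= mulr1n mulr0n => ea.
  transitivity (a ^+ 2 -
    ((X 0 0 + X 1 1) * a - (X 0 0 * X 1 1 - X 0 1 * X 1 0))).
    by ring.
  by rewrite ea subrr.
exists v => //; apply/eqP; rewrite -subr_eq0; apply/eqP.
by rewrite -mul_mx_scalar -mulmxBr.
Qed.

(** The matrices of X and Y, acting on row vectors, in the basis v, vY where v
is an eigenvector of X for a; here x, y, z are the traces of X, Y, XY and d is
the determinant of Y. *)
Definition normal_form1 (x y z a : F) := mx2 a 0 (z - (x - a) * y) (x - a).
Definition normal_form2 (y d : F) := mx2 0 1 (- d) y.

(** If v and vY were proportional, v would be a common eigenvector and would
be killed by the commutator. So they form a basis; the second rows of the two
matrices come from multiplying the anticommutator and Cayley-Hamilton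
identities by v on the left. *)
Lemma pair_normal_form X Y (a : F) : a ^+ 2 = \tr X * a - \det X ->
  \det (lie_mx X Y) != 0 -> exists2 h, h \in unitmx &
    h *m X = normal_form1 (\tr X) (\tr Y) (\tr (X *m Y)) a *m h /\
    h *m Y = normal_form2 (\tr Y) (\det Y) *m h.
Proof.
move=> ea dXY; have [v nv ev] := left_eigenvector ea.
(* Not a local definition, so that [mxE] leaves the entries of w alone. *)
have [w ew] : exists w, w = v *m Y by exists (v *m Y).
pose h := mx2 (v 0 0) (v 0 1) (w 0 0) (w 0 1).
have rowE (u : 'rV[F]_2) (Z : 'M_2) j :
    (u *m Z) 0 j = u 0 0 * Z 0 j + u 0 1 * Z 1 j.
  rewrite mxE !big_ord_recl big_ord0 addr0; congr (_ + u _ _ * Z _ _);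
    exact/val_inj.
have ewX : w *m X =
    (\tr (X *m Y) - (\tr X - a) * \tr Y) *: v + (\tr X - a) *: w.
  have := congr1 (mulmx v) (anticommutator X Y).
  rewrite !mulmxDr -!scalemxAr mulmx1 !mulmxA ev -scalemxAl -ew.
  move/(canRL (addKr _)) => ->; apply/matrixP=> i j; rewrite !mxE; ring.
have ewY : w *m Y = - \det Y *: v + \tr Y *: w.
  have := congr1 (mulmx v) (Cayley_Hamilton2 Y).
  rewrite mulmxBr -!scalemxAr mulmx1 !mulmxA -ew => ->.
  by rewrite scaleNr addrC.
have uh : h \in unitmx.
  rewrite unitmxE unitfE; apply: contra dXY => /eqP dh.
  rewrite !mx2_simp in dh.
  have [c ewv] : exists c, w = c *: v.
    have [v0|v0] := eqVneq (v 0 0) 0; last first.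
      exists (w 0 0 / v 0 0); apply: rV2P; rewrite [RHS]mxE ?divfK //.
      apply: (mulfI v0); rewrite mulrA mulrCA divff // mulr1.
      by apply/eqP; rewrite -subr_eq0 [w 0 0 * _]mulrC dh.
    have v1 : v 0 1 != 0.
      by apply: contraNneq nv => v1; apply/eqP/rV2P; rewrite mxE.
    exists (w 0 1 / v 0 1); apply: rV2P; rewrite [RHS]mxE ?divfK //.
    move: dh; rewrite v0 mul0r sub0r mulr0 => /eqP.
    by rewrite oppr_eq0 mulf_eq0 (negPf v1) => /eqP.
  apply/det0P; exists v => //.
  by rewrite /lie_mx mulmxBr !mulmxA ev -scalemxAl -ew ewv -scalemxAl ev
    !scalerA [a * c]mulrC subrr.
exists h => //; split; apply: mx2P;
  rewrite [LHS]mulmx2E [RHS]mulmx2E !mx2E -rowE ?ev -?ew ?ewX ?ewY ?mxE; ring.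
Qed.

(** Conjugation by an invertible matrix is conjugation by an element of SL2,
since the determinant has a square root. *)
Lemma SL2_normalize (h : 'M[F]_2) : h \in unitmx ->
  exists (g : sl2 F) (c : F), c != 0 /\ h = c *: (g : 'M_2).
Proof.
rewrite unitmxE unitfE => nz.
have [c ec] := root_quadratic 0 (\det h); rewrite mul0r add0r in ec.
have nc : c != 0 by apply: contraNneq nz => c0; rewrite -ec c0 expr0n.
have dg : \det (c^-1 *: h) == 1.
  by rewrite detZ exprVn ec mulVf.
by exists (SL2 dg), c; split; rewrite //= scalerA divff ?scale1r.
Qed.

(** Both pairs have the same normal form, provided that the same root of the
common characteristic polynomial of X and X' is used. *)
Lemma pair_conjugate X Y X' Y' :
  \det (lie_mx X Y) != 0 ->
  \tr X = \tr X' -> \det X = \det X' ->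
  \tr Y = \tr Y' -> \det Y = \det Y' ->
  \tr (X *m Y) = \tr (X' *m Y') ->
  exists g : sl2 F, g *m X = X' *m g /\ g *m Y = Y' *m g.
Proof.
move=> dXY tX dX tY dY tXY.
have [a ea] := root_quadratic (\tr X) (- \det X).
have dXY' : \det (lie_mx X' Y') != 0.
  by rewrite det_lie_mxE -tX -dX -tY -dY -tXY -det_lie_mxE.
have [h uh [hX hY]] := pair_normal_form ea dXY.
rewrite tX dX in ea; have [h' uh' [hX' hY']] := pair_normal_form ea dXY'.
have uk : invmx h' *m h \in unitmx by rewrite unitmx_mul unitmx_inv uh' uh.
have intertwine Z Z' C : h *m Z = C *m h -> h' *m Z' = C *m h' ->
    invmx h' *m h *m Z = Z' *m (invmx h' *m h).
  move=> hZ hZ'; rewrite -mulmxA hZ mulmxA -[C in LHS]mulmx1.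
  by rewrite -(mulmxV uh') mulmxA -hZ' !mulmxA mulVmx // mul1mx.
have [g [c [nc eg]]] := SL2_normalize uk.
exists g; split; apply: (scalerI nc); rewrite scalemxAl scalemxAr -eg.
  by apply: intertwine hX _; rewrite hX' tX tY tXY.
by apply: intertwine hY _; rewrite hY' tY dY.
Qed.

(** Once the pair (X, Y) is matched with (X', Y'), any further matrix is
determined by its traces against the basis I, X, Y, XY, so the same g conjugates
Z to Z': the difference of Z and the pullback of Z' is orthogonal to that
basis. *)
Lemma conjugate_of_traces (g : sl2 F) X Y Z X' Y' Z' :
  \det (lie_mx X Y) != 0 -> g *m X = X' *m g -> g *m Y = Y' *m g ->
  \tr Z = \tr Z' -> \tr (Z *m X) = \tr (Z' *m X') ->
  \tr (Z *m Y) = \tr (Z' *m Y') ->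
  \tr (Z *m (X *m Y)) = \tr (Z' *m (X' *m Y')) -> g *m Z = Z' *m g.
Proof.
move=> dXY gX gY t tX tY tXY.
have ug := sl2_unit g.
pose D := invmx g *m Z' *m g - Z.
suff /eqP : D = 0.
  by rewrite subr_eq0 => /eqP <-; rewrite !mulmxA mulmxV // mul1mx.
have gXY : g *m (X *m Y) = (X' *m Y') *m g.
  by rewrite mulmxA gX -[LHS]mulmxA gY mulmxA.
have trD W W' : g *m W = W' *m g -> \tr (Z *m W) = \tr (Z' *m W') ->
    \tr (D *m W) = 0.
  move=> gW tW; rewrite mulmxBl raddfB /= -!mulmxA gW mxtrace_mulC.
  by rewrite -!mulmxA mulmxV // mulmx1 -tW subrr.
apply: trace_form_nondegenerate dXY _ (trD _ _ gX tX) (trD _ _ gY tY)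
  (trD _ _ gXY tXY).
by rewrite -[D]mulmx1; apply: (@trD _ 1%:M); rewrite ?mulmx1 ?mul1mx.
Qed.
End NormalForm.

(** * Simultaneous triangularization *)

Section Triangular.
Variable F : closedFieldType.
Implicit Types (X Y Z : 'M[F]_2) (g : sl2 F).

(** Defined on all matrices because it is also applied to sums and commutators
of elements of SL2. *)
Definition sl2_conj g X : 'M[F]_2 := g *m X *m invmx g.

Lemma sl2_conj_comp g h X : sl2_conj (g * h)%g X = sl2_conj g (sl2_conj h X).
Proof.
have eV : invmx (g *m h) = invmx h *m invmx g.
  by have := congr1 (@sl2_mx F) (invgM g h).
by rewrite /sl2_conj /= eV !mulmxA.
Qed.

Lemma sl2_conjM g X Y : sl2_conj g (X *m Y) = sl2_conj g X *m sl2_conj g Y.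
Proof. by rewrite /sl2_conj !mulmxA mulmxKV ?sl2_unit. Qed.

Lemma sl2_conjD g X Y : sl2_conj g (X + Y) = sl2_conj g X + sl2_conj g Y.
Proof. by rewrite /sl2_conj mulmxDr mulmxDl. Qed.

Lemma sl2_conj_lie g X Y :
  sl2_conj g (lie_mx X Y) = lie_mx (sl2_conj g X) (sl2_conj g Y).
Proof. by rewrite /lie_mx -!sl2_conjM /sl2_conj mulmxBr mulmxBl. Qed.

Lemma det_sl2_conj g X : \det (sl2_conj g X) = \det X.
Proof. by rewrite !det_mulmx det_inv det_sl2 invr1 mulr1 mul1r. Qed.

Lemma sl2_conj_scalar g X a : sl2_conj g X = a%:M -> X = a%:M.
Proof.
move=> e; have ug := sl2_unit g.
have -> : X = invmx g *m sl2_conj g X *m g.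
  by rewrite /sl2_conj !mulmxA mulVmx // mul1mx mulmxKV.
by rewrite e mul_mx_scalar -scalemxAl mulVmx // scalemx1.
Qed.

Lemma tr_sl2_conj g X : \tr (sl2_conj g X) = \tr X.
Proof. by rewrite /sl2_conj mxtrace_mulC mulmxA mulVmx ?sl2_unit // mul1mx. Qed.

Lemma triangularize X : exists g, sl2_conj g X 1 0 = 0.
Proof.
have [a ea] := root_quadratic (\tr X) (- \det X).
have [v nv ev] := left_eigenvector ea.
(* v is completed to a basis by a coordinate vector r, put in the first row. *)
have [r nr] : exists r : 'rV[F]_2, r 0 0 * v 0 1 - r 0 1 * v 0 0 != 0.
  have [v0|v0] := eqVneq (v 0 0) 0; last first.
    exists (\row_j (j == 1)%:R).
    by rewrite !mxE /= mul0r sub0r mul1r oppr_eq0.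
  exists (\row_j (j == 0)%:R); rewrite !mxE /= mul1r mul0r subr0.
  by apply: contraNneq nv => v1; apply/eqP/rV2P; rewrite ?v0 ?v1 mxE.
pose h := mx2 (r 0 0) (r 0 1) (v 0 0) (v 0 1).
have uh : h \in unitmx by rewrite unitmxE unitfE det2E !mx2E.
have [g [c [nc eg]]] := SL2_normalize uh.
have rowg : row 1 (g : 'M_2) = c^-1 *: v.
  apply: (scalerI nc); rewrite scalerA divff // scale1r -linearZ /= -eg.
  by apply: rV2P; rewrite !mxE.
exists g.
have -> : sl2_conj g X 1 0 = row 1 (sl2_conj g X) 0 0 by rewrite [RHS]mxE.
rewrite !row_mul rowg -scalemxAl ev scalerA mulrC -scalerA -rowg -scalemxAl.
by rewrite -row_mul mulmxV ?sl2_unit // !mxE /= mulr0.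
Qed.

Lemma det_lieD X Y Z : \det (lie_mx X (Y + Z)) =
  \det (lie_mx X Y) + \det (lie_mx X Z) - \tr (lie_mx X Y *m lie_mx X Z).
Proof. rewrite /lie_mx !mx2_simp; ring. Qed.

(** If all A i commute, triangularizing one with a nonzero lower left entry,
hence nonscalar, triangularizes the others. Otherwise some commutator
L = [A i, A j] is nonzero; it is nilpotent, and in a basis where L is strictly
upper triangular every A k is upper triangular. For k = i, j this is because L
is orthogonal to A i and A j for the trace form. For a general k the second
hypothesis, polarized by [det_lieD], says that L is orthogonal to [A i, A k] and
to [A j, A k], i.e. that these are upper triangular; as L is nonzero, A i or A j
has distinct diagonal entries, which forces A k to be upper triangular too.

The second hypothesis cannot be dropped: three diagonalizable nonscalar matrices
with eigenlines {p, q}, {q, r}, {r, p} respectively have a common eigenvector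
two by two, but not all together. *)
Lemma common_triangular (I : finType) (A : I -> 'M[F]_2) :
  (forall i j, \det (lie_mx (A i) (A j)) = 0) ->
  (forall i j k, \det (lie_mx (A i) (A j + A k)) = 0) ->
  exists g, forall i, sl2_conj g (A i) 1 0 = 0.
Proof.
move=> d2 d3.
have [/forallP comm|/forallPn /= [i /forallPn [j nij]]] :=
  boolP [forall i, forall j, lie_mx (A i) (A j) == 0].
  have [/forallP tri|/forallPn [i nAi]] := boolP [forall i, A i 1 0 == 0].
    exists 1%g => i; rewrite /sl2_conj mul1mx invmx1 mulmx1; exact/eqP/tri.
  have [g tri] := triangularize (A i); exists g => k.
  have : lie_mx (sl2_conj g (A i)) (sl2_conj g (A k)) = 0.
    rewrite -sl2_conj_lie (eqP (forallP (comm i) k)).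
    by rewrite /sl2_conj mulmx0 mul0mx.
  have nscal a : sl2_conj g (A i) <> a%:M.
    by move/sl2_conj_scalar=> e; rewrite e !mxE /= eqxx in nAi.
  move: (sl2_conj g (A i)) (sl2_conj g (A k)) tri nscal => X Z X10 nscal L0.
  apply/eqP/negPn/negP => nZ.
  apply: (nscal (X 0 0)); apply: mx2P; rewrite !mxE //=.
    apply: (mulIf nZ); rewrite mul0r; move: (congr1 (fun M : 'M_2 => M 0 0) L0).
    by rewrite /lie_mx !mx2_simp X10 mxE => <-; ring.
  apply: (mulIf nZ); apply/eqP; rewrite -subr_eq0; apply/eqP.
  move: (congr1 (fun M : 'M_2 => M 1 0) L0).
  by rewrite /lie_mx !mx2_simp X10 mxE => <-; rewrite /=; ring.
have [g tri] := triangularize (lie_mx (A i) (A j)); exists g => k.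
rewrite sl2_conj_lie in tri.
have nL : lie_mx (sl2_conj g (A i)) (sl2_conj g (A j)) <> 0.
  have -> : 0 = 0%:M :> 'M[F]_2 by rewrite raddf0.
  rewrite -sl2_conj_lie => /sl2_conj_scalar e.
  by rewrite e raddf0 eqxx in nij.
have d2' a b : \det (lie_mx (sl2_conj g (A a)) (sl2_conj g (A b))) = 0.
  by rewrite -sl2_conj_lie det_sl2_conj.
have d3' a b c : \tr (lie_mx (sl2_conj g (A a)) (sl2_conj g (A b)) *m
                      lie_mx (sl2_conj g (A a)) (sl2_conj g (A c))) = 0.
  have := d3 a b c; rewrite -(det_sl2_conj g) sl2_conj_lie sl2_conjD det_lieD.
  by rewrite !d2' addr0 sub0r => /eqP; rewrite oppr_eq0 => /eqP.
have := d3' j i k; have := d3' i j k; have := d2' i j; move: tri nL.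
move: (sl2_conj g (A i)) (sl2_conj g (A j)) (sl2_conj g (A k)) => X Y Z.
set L := lie_mx X Y => L10 nL dL tX tY.
have L11 : L 1 1 = - L 0 0 by rewrite /L /lie_mx !mx2_simp; ring.
have L00 : L 0 0 = 0.
  apply/eqP; move: dL; rewrite det2E L10 L11 mulr0 subr0 => /eqP.
  by rewrite mulrN oppr_eq0 mulf_eq0 orbb.
have nL01 : L 0 1 != 0.
  apply/eqP=> L01; apply: nL; apply: mx2P; rewrite ?L11 ?L00 ?L01 ?L10 ?mxE //.
  exact: oppr0.
have cancel e : L 0 1 * e = 0 -> e = 0.
  by move/eqP; rewrite mulf_eq0 (negPf nL01) => /eqP.
have X10 : X 1 0 = 0.
  apply: cancel; have : \tr (X *m L) = 0 by rewrite /L /lie_mx !mx2_simp; ring.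
  by rewrite mxtrace2E !mulmx2E L10 L11 L00 => <-; ring.
have Y10 : Y 1 0 = 0.
  apply: cancel; have : \tr (Y *m L) = 0 by rewrite /L /lie_mx !mx2_simp; ring.
  by rewrite mxtrace2E !mulmx2E L10 L11 L00 => <-; ring.
have XZ : lie_mx X Z 1 0 = 0.
  apply: cancel; move: tX; rewrite mxtrace2E !mulmx2E L10 L11 L00 => <-.
  ring.
have YZ : lie_mx Y Z 1 0 = 0.
  have eL : lie_mx Y X = - L by rewrite /L /lie_mx opprB.
  apply: cancel; move: tY; rewrite eL mulNmx raddfN /=.
  rewrite mxtrace2E !mulmx2E L10 L11 L00 => /eqP; rewrite oppr_eq0 => /eqP <-.
  ring.
(* L 0 1 is a combination of the differences of the diagonal entries of X and Y;
   multiplied by Z 1 0, these are the entries XZ and YZ. *)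
apply: cancel; transitivity (X 0 1 * lie_mx Y Z 1 0 - Y 0 1 * lie_mx X Z 1 0).
  by rewrite /L /lie_mx !mx2_simp X10 Y10; ring.
by rewrite XZ YZ !mulr0 subr0.
Qed.
End Triangular.

(** * Families with equal traces *)

Section Families.
Variable F : closedFieldType.

(** The agreement of triple traces is invariant under cyclic rotations, by the
symmetry of the trace, and under the exchange of two factors, by [tr_swap]; so
it is enough to know it for increasing indices, repetitions being covered by
[tr_dup]. *)
Lemma triple_traces (n : nat) (A B : 'I_n -> 'M[F]_2) :
  (forall i, \det (A i) = \det (B i)) -> (forall i, \tr (A i) = \tr (B i)) ->
  (forall i j, \tr (A i *m A j) = \tr (B i *m B j)) ->
  (forall i j k : 'I_n, (i < j < k)%N ->
     \tr (A i *m A j *m A k) = \tr (B i *m B j *m B k)) ->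
  forall i j k, \tr (A i *m A j *m A k) = \tr (B i *m B j *m B k).
Proof.
move=> d t1 t2 t3.
pose P i j k := \tr (A i *m A j *m A k) = \tr (B i *m B j *m B k).
have rot i j k : P i j k -> P j k i.
  by rewrite /P => e; rewrite mxtrace_mulC mulmxA e -mulmxA mxtrace_mulC.
have swap i j k : P i j k -> P j i k.
  by rewrite /P => e; rewrite (tr_swap (A i)) (tr_swap (B i)) e !t1 !t2.
have dup i k : P i i k by rewrite /P !tr_dup d !t1 t2.
have sorted (i j k : 'I_n) : (i <= j <= k)%N -> P i j k.
  move=> /andP [ij jk]; have [->|nij] := eqVneq i j; first exact: dup.
  have [->|njk] := eqVneq j k; first exact/rot/rot/dup.
  by apply: t3; rewrite !ltn_neqAle ij jk nij njk.
move=> i j k; rewrite -/(P i j k).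
have [ij|/ltnW ij] := leqP i j; have [jk|/ltnW jk] := leqP j k.
- by apply: sorted; rewrite ij.
- have [ik|/ltnW ik] := leqP i k.
    by apply/rot/swap/sorted; rewrite ik.
  by apply/rot/sorted; rewrite ik.
- have [ik|/ltnW ik] := leqP i k.
    by apply/swap/sorted; rewrite ij.
  by apply/rot/rot/sorted; rewrite jk.
by apply/rot/rot/swap/sorted; rewrite jk.
Qed.

(** If the A i have no common eigenvector, [common_triangular] provides a pair
(A i, A j) or (A i, A j + A k) with invertible commutator. All traces needed to
conjugate this pair and then each remaining A l are sums of traces of at most
three factors; that the second member may be a sum rather than a product is what
keeps quadruple traces out, in every characteristic. *)
Lemma conjugate_or_triangular (I : finType) (A B : I -> 'M[F]_2) :
  (forall i, \det (A i) = \det (B i)) -> (forall i, \tr (A i) = \tr (B i)) ->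
  (forall i j, \tr (A i *m A j) = \tr (B i *m B j)) ->
  (forall i j k, \tr (A i *m A j *m A k) = \tr (B i *m B j *m B k)) ->
  (exists g, forall i, sl2_conj g (A i) 1 0 = 0) \/
  (exists g : sl2 F, forall i, g *m A i = B i *m g).
Proof.
move=> d t1 t2 t3.
have t3' i j k : \tr (A i *m (A j *m A k)) = \tr (B i *m (B j *m B k)).
  by rewrite !mulmxA.
have [/forallP d2|/forallPn /= [i /forallPn [j dij]]] :=
  boolP [forall i, forall j, \det (lie_mx (A i) (A j)) == 0]; last first.
  have [g [gi gj]] := pair_conjugate dij (t1 i) (d i) (t1 j) (d j) (t2 i j).
  right; exists g => k.
  exact: conjugate_of_traces dij gi gj (t1 k) (t2 k i) (t2 k j) (t3' k i j).
have [/forallP d3|/forallPn /= [i /forallPn [j /forallPn [k dijk]]]] :=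
  boolP [forall i, forall j, forall k, \det (lie_mx (A i) (A j + A k)) == 0].
  left; apply: common_triangular => [i j | i j k].
    exact/eqP/(forallP (d2 i)).
  exact/eqP/(forallP (forallP (d3 i) j)).
have tD X Y X' Y' Z Z' : \tr (Z *m X) = \tr (Z' *m X') :> F ->
    \tr (Z *m Y) = \tr (Z' *m Y') ->
    \tr (Z *m (X + Y : 'M_2)) = \tr (Z' *m (X' + Y' : 'M_2)).
  by move=> eX eY; rewrite !mulmxDr !raddfD /= eX eY.
have [g [gX gY]] : exists g : sl2 F, g *m A i = B i *m g /\
    g *m (A j + A k) = (B j + B k) *m g.
  apply: pair_conjugate => //; first by rewrite !raddfD /= !t1.
    by rewrite !det_add !d !t1 t2.
  exact: tD.
right; exists g => l; apply: conjugate_of_traces dijk gX gY (t1 l) (t2 l i) _ _.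
  exact: tD.
by rewrite (mulmxDr (A i)) (mulmxDr (B i)); apply: tD.
Qed.

(** Entrywise the pairs agree up to order. If the order is reversed at i and
not at j, the product condition gives (a i - a' i) (a j - a' j) = 0, so that the
order does not matter at one of them. *)
Lemma diagonals_match (I : finType) (a a' b b' : I -> F) :
  (forall i, a i * a' i = 1) -> (forall i, b i * b' i = 1) ->
  (forall i, a i + a' i = b i + b' i) ->
  (forall i j, a i * a j + a' i * a' j = b i * b j + b' i * b' j) ->
  (forall i, b i = a i /\ b' i = a' i) \/ (forall i, b i = a' i /\ b' i = a i).
Proof.
move=> pa pb s1 s2.
have eb' i : b' i = a i + a' i - b i by rewrite s1 [RHS]addrC addKr.
have cases i : b i = a i \/ b i = a' i.
  have /eqP : (b i - a i) * (b i - a' i) = 0.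
    transitivity (b i * b i - (a i + a' i) * b i + a i * a' i); first by ring.
    by rewrite pa s1 -(pb i); ring.
  by rewrite mulf_eq0 !subr_eq0 => /orP [] /eqP; [left | right].
have [/forallP e|/forallPn /= [i nbi]] := boolP [forall i, b i == a i].
  by left=> i; rewrite eb' (eqP (e i)); split; rewrite // addrC addKr.
have bi : b i = a' i by case: (cases i) => // e; rewrite e eqxx in nbi.
have bi' : b' i = a i by rewrite eb' bi addrK.
suff bj j : b j = a' j by right=> j; rewrite eb' bj addrK.
case: (cases j) => // bj; have bj' : b' j = a' j by rewrite eb' bj addrC addKr.
rewrite bj; apply/eqP; rewrite -subr_eq0; apply/eqP.
rewrite bi eq_sym -subr_eq0 in nbi; apply: (mulfI nbi).
move/eqP: (s2 i j); rewrite bi bi' bj bj' -subr_eq0 mulr0 => /eqP <-; ring.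
Qed.
End Families.

(** * Orbit closures *)

Section Closures.
Variables (F : closedFieldType) (G : groupType) (n : nat) (gam : 'I_n -> G).
Implicit Types rho sigma chi psi : 'Hom_SL2(G, F).

Lemma hom_of_morph (f : G -> sl2 F) :
  {morph f : x y / (x * y)%g} -> exists chi : 'Hom_SL2(G, F), chi =1 f.
Proof.
move=> fM; pose chi : 'Hom_SL2(G, F) :=
  HB.pack f (isMultiplicative.Build G (sl2 F) f fM).
by exists chi.
Qed.

Lemma hom1 chi : chi 1%g = 1%g.
Proof. by apply: (mulgI (chi 1%g)); rewrite -gmulfM !mulg1. Qed.

Lemma homF chi x y : chi (x / y)%g = (chi x / chi y)%g.
Proof.
apply: (mulIg (chi y)); rewrite -gmulfM.
by rewrite -!mulgA !mulVg !mulg1.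
Qed.

Lemma conj_hom rho (g : sl2 F) :
  exists chi : 'Hom_SL2(G, F), forall x, chi x = (g * rho x * g^-1)%g.
Proof.
apply: hom_of_morph => x y.
by rewrite gmulfM -[(g * rho y * _)%g]mulgA divgKA !mulgA.
Qed.

(** The inverse in SL2 is the adjugate, hence polynomial. *)
Lemma entries_poly (x : G) : generates gam ->
  exists P : 'M[{mpoly F[n * (2 * 2)]}]_2,
    forall chi, (chi x : 'M[F]_2) = map_mx (meval (rep_coord gam chi)) P.
Proof.
move=> hgam; move: x; apply: hgam => [|x y [P eP] [Q eQ]|i].
- by exists 1%:M => chi; rewrite hom1 map_mx1.
- exists (P *m \adj Q) => chi; rewrite homF map_mxM map_mx_adj -eP -eQ /=.
  by rewrite /invmx sl2_unit det_sl2 invr1 scale1r.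
exists (\matrix_(a, b) 'X_(mxvec_index i (mxvec_index a b))) => chi.
by apply/matrixP=> a b; rewrite !mxE mevalXU /rep_coord mxvecE mxE mxvecE.
Qed.

(** Traces are polynomial functions of the representation, invariant under
conjugation, so they are constant on the closure of an orbit. *)
Lemma char_closure rho chi x : generates gam ->
  zariski_closure gam (conj_orbit rho) chi -> rep_char chi x = rep_char rho x.
Proof.
move=> hgam cl; have [P eP] := entries_poly x hgam.
pose p : {mpoly F[n * (2 * 2)]} := \tr P - (rep_char rho x)%:MP.
have ep psi : p.@[rep_coord gam psi] = rep_char psi x - rep_char rho x.
  rewrite /p mevalB mevalC; congr (_ - _); rewrite /rep_char (eP psi).
  exact: (esym (trace_map_mx _ _)).
apply: (cl (fun psi => rep_char psi x = rep_char rho x)).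
  exists (eq p) => psi; split=> [e q <-|/(_ _ erefl)].
    by rewrite ep e subrr.
  by rewrite ep => /eqP; rewrite subr_eq0 => /eqP.
by move=> psi [g eg]; rewrite /rep_char eg /= mxtrace_mulC mulmxA mulVmx
  ?sl2_unit // mul1mx.
Qed.

Lemma meval_line (m : nat) (P : 'I_m -> {poly F}) (p : {mpoly F[m]}) :
  exists q : {poly F}, forall t, q.[t] = p.@[fun k => (P k).[t]].
Proof.
exists (mmap polyC P p) => t.
rewrite mevalE /mmap horner_sum; apply: eq_bigr => k _.
by rewrite hornerM hornerC horner_prod; congr (_ * _); apply: eq_bigr => i _;
  rewrite horner_exp.
Qed.

(** A nonzero q with this property would make q X + 1 a nonconstant polynomial
without roots. *)
Lemma horner0_of_nonzero (q : {poly F}) :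
  (forall t, t != 0 -> q.[t] = 0) -> q.[0] = 0.
Proof.
move=> q0; have [->|nq] := eqVneq q 0; first by rewrite horner0.
have [t] : exists t, root (q * 'X + 1) t.
  apply/closed_rootP; rewrite size_polyDl ?size_mulX //.
    by rewrite eqSS size_poly_eq0.
  by rewrite size_poly1 ltnS size_poly_gt0.
rewrite /root !hornerE; have [->|nt] := eqVneq t 0.
  by rewrite mulr0 add0r oner_eq0.
by rewrite (q0 t nt) mul0r add0r oner_eq0.
Qed.

(** A polynomial curve in the representation space that lies in an orbit for
t <> 0 has its value at 0 in the closure: an equation of the closure restricts
to the curve as a polynomial in t which vanishes for t <> 0. *)
Lemma degeneration rho chi (M : 'I_n -> 'M[{poly F}]_2) :
  (forall t, t != 0 -> exists g : sl2 F, forall i,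
     sl2_conj g (rho (gam i)) = map_mx (horner_eval t) (M i)) ->
  (forall i, (chi (gam i) : 'M_2) = map_mx (horner_eval 0) (M i)) ->
  zariski_closure gam (conj_orbit rho) chi.
Proof.
move=> Mt M0 Z [I ZI] orbZ; apply/ZI => p Ip.
pose P k : {poly F} := mxvec (\matrix_(i < n) mxvec (M i)) 0 k.
have coordP psi t :
    (forall i, (psi (gam i) : 'M_2) = map_mx (horner_eval t) (M i)) ->
    p.@[rep_coord gam psi] = p.@[fun k => (P k).[t]].
  move=> e; apply: meval_eq => k.
  rewrite /rep_coord /P; set rows := \matrix_i _.
  have -> : rows = map_mx (horner_eval t) (\matrix_(i < n) mxvec (M i)).
    by apply/row_matrixP=> i; rewrite rowK -map_row rowK map_mxvec e.
  by rewrite -map_mxvec mxE.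
have [q eq] := meval_line P p.
rewrite (coordP _ _ M0) -eq; apply: horner0_of_nonzero => t nt.
have [g eg] := Mt t nt; have [psi epsi] := conj_hom rho g.
rewrite eq -(coordP psi) => [|i]; last by rewrite epsi -eg.
by move: p Ip {coordP eq}; apply/ZI/orbZ; exists g.
Qed.

(** Conjugating by diag(t, 1/t) multiplies the upper right entries by t ^ 2
and keeps the diagonal. The further conjugation by c serves to reach both orders
of the diagonal entries. *)
Lemma triangular_degeneration rho chi (g c : sl2 F) :
  (forall i, sl2_conj g (rho (gam i)) 1 0 = 0) ->
  (forall i, (chi (gam i) : 'M_2) = sl2_conj c
     (mx2 (sl2_conj g (rho (gam i)) 0 0) 0 0 (sl2_conj g (rho (gam i)) 1 1))) ->
  zariski_closure gam (conj_orbit rho) chi.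
Proof.
move=> tri echi.
pose U i := sl2_conj g (rho (gam i)).
have Ui10 i : U i 1 0 = 0 := tri i.
pose T i : 'M[{poly F}]_2 :=
  mx2 (U i 0 0)%:P ((U i 0 1)%:P * 'X^2) 0 (U i 1 1)%:P.
pose C (A : 'M[F]_2) : 'M[{poly F}]_2 := map_mx polyC A.
have evC t A : map_mx (horner_eval t) (C A) = A.
  by apply/matrixP=> i j; rewrite !mxE /horner_eval hornerC.
have evT t i : map_mx (horner_eval t) (T i) =
    mx2 (U i 0 0) (U i 0 1 * t ^+ 2) 0 (U i 1 1).
  by apply: mx2P; rewrite mxE !mx2E /horner_eval !hornerE.
apply: (@degeneration _ _ (fun i => C c *m T i *m C (invmx c))) => [t nt|i].
  have dt : \det (mx2 t 0 0 t^-1) == 1 by rewrite det2E !mx2E mulr0 subr0 divff.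
  pose h : sl2 F := SL2 dt.
  exists (c * h * g)%g => i; rewrite !map_mxM !evC evT /=.
  transitivity (sl2_conj c (sl2_conj h (U i))).
    by rewrite !sl2_conj_comp.
  congr (_ *m _ *m _).
  apply: (can_inj (mulmxK (sl2_unit h))).
  rewrite /sl2_conj mulmxKV ?sl2_unit //.
  move: (U i) (Ui10 i) => V V10.
  by apply: mx2P; rewrite !mulmx2E /h /= !mx2E ?V10; field.
rewrite !map_mxM !evC evT echi; congr (_ *m _ *m _).
by rewrite expr0n mulr0.
Qed.

End Closures.

(** * From triple products to closure-equivalence *)

Section Main.
Variables (F : closedFieldType) (G : groupType) (n : nat) (gam : 'I_n -> G).
Implicit Types rho sigma chi psi : 'Hom_SL2(G, F).

Lemma tr_mul_upper (X Y : 'M[F]_2) : X 1 0 = 0 -> Y 1 0 = 0 ->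
  \tr (X *m Y) = X 0 0 * Y 0 0 + X 1 1 * Y 1 1.
Proof.
by move=> X10 Y10; rewrite mxtrace2E !mulmx2E X10 Y10 mulr0 mul0r addr0 add0r.
Qed.

(** On upper triangular matrices, taking the diagonal part is
multiplicative. *)
Lemma diagonal_part rho (g : sl2 F) : generates gam ->
  (forall i, sl2_conj g (rho (gam i)) 1 0 = 0) ->
  exists chi : 'Hom_SL2(G, F), forall x, (chi x : 'M_2) =
    mx2 (sl2_conj g (rho x) 0 0) 0 0 (sl2_conj g (rho x) 1 1).
Proof.
move=> hgam tri; have [psi epsi] := conj_hom rho g.
have eU x : sl2_conj g (rho x) = psi x by rewrite epsi.
have {}tri x : psi x 1 0 = 0.
  move: x; apply: hgam => [|x y tx ty|i].
  - by rewrite hom1 mxE.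
  - have d y1 : psi y1 1 0 = 0 -> psi y1 1 1 != 0.
      move=> t; have := det_sl2 (psi y1); rewrite det2E t mulr0 subr0 => e.
      by apply: contra_eq_neq e => ->; rewrite mulr0 eq_sym oner_eq0.
    have := congr1 (fun A : 'M[F]_2 => A 1 0) (mulmxV (sl2_unit (psi y))).
    rewrite mulmx2E ty mul0r add0r mxE /= => /eqP.
    rewrite mulf_eq0 (negPf (d y ty)) => /eqP V10.
    by rewrite homF /= mulmx2E tx V10 mul0r mulr0 addr0.
  by rewrite -eU.
have dD x : \det (mx2 (psi x 0 0) 0 0 (psi x 1 1)) == 1.
  by rewrite -(det_sl2 (psi x)) !det2E !mx2E tri !mulr0.
have [x y|chi echi] := hom_of_morph (f := fun x => SL2 (dD x)).
  apply/val_inj; rewrite /= gmulfM /=.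
  by apply: mx2P; rewrite !mulmx2E !mx2E ?tri; ring.
by exists chi => x; rewrite echi !eU.
Qed.

Lemma mem_closure rho chi :
  conj_orbit rho chi -> zariski_closure gam (conj_orbit rho) chi.
Proof. by move=> orb Z _; apply. Qed.

Lemma conj_orbit_refl rho : conj_orbit rho rho.
Proof. by exists 1%g => x; rewrite mul1g invg1 mulg1. Qed.

Lemma conj_orbit_gen rho sigma (g : sl2 F) : generates gam ->
  (forall i, (g : 'M_2) *m rho (gam i) = sigma (gam i) *m (g : 'M_2)) ->
  conj_orbit rho sigma.
Proof.
move=> hgam e; exists g; have [psi epsi] := conj_hom rho g => x; rewrite -epsi.
move: x; apply: hgam => [|x y ex ey|i]; first by rewrite !hom1.
  by rewrite !homF ex ey.
by apply/val_inj; rewrite epsi /= e -mulmxA mulmxV ?sl2_unit // mulmx1.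
Qed.

(** Both orbits degenerate to a diagonal representation. By [diagonals_match]
the two limits have the same diagonals up to a global exchange of the two
entries, which conjugation by an antidiagonal matrix realizes. *)
Lemma closure_equiv_triangular rho sigma (g h : sl2 F) : generates gam ->
  (forall i, rep_char rho (gam i) = rep_char sigma (gam i)) ->
  (forall i j,
     rep_char rho (gam i * gam j)%g = rep_char sigma (gam i * gam j)%g) ->
  (forall i, sl2_conj g (rho (gam i)) 1 0 = 0) ->
  (forall i, sl2_conj h (sigma (gam i)) 1 0 = 0) ->
  closure_equiv gam rho sigma.
Proof.
move=> hgam t1 t2 tg th; have [chi echi] := diagonal_part hgam tg.
pose U i := sl2_conj g (rho (gam i)); pose V i := sl2_conj h (sigma (gam i)).
have weyl : \det (mx2 0 1 (-1) 0 : 'M[F]_2) == 1.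
  by rewrite det2E !mx2E mulr0 sub0r mulrN1 opprK.
have closure c : (forall i, (chi (gam i) : 'M_2) =
    sl2_conj c (mx2 (V i 0 0) 0 0 (V i 1 1))) -> closure_equiv gam rho sigma.
  move=> ec; exists chi; split; last exact: triangular_degeneration th ec.
  apply: (triangular_degeneration (c := 1%g) tg) => i.
  by rewrite echi /sl2_conj /= mul1mx invmx1 mulmx1.
have dU i : U i 0 0 * U i 1 1 = 1.
  by rewrite -(det_sl2 (rho (gam i))) -(det_sl2_conj g)
    det2E [in RHS]tg mulr0 subr0.
have dV i : V i 0 0 * V i 1 1 = 1.
  by rewrite -(det_sl2 (sigma (gam i))) -(det_sl2_conj h)
    det2E [in RHS]th mulr0 subr0.
have sUV i : U i 0 0 + U i 1 1 = V i 0 0 + V i 1 1.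
  by rewrite -!mxtrace2E !tr_sl2_conj; apply: t1.
have tUV i j : U i 0 0 * U j 0 0 + U i 1 1 * U j 1 1 =
               V i 0 0 * V j 0 0 + V i 1 1 * V j 1 1.
  have : \tr (U i *m U j) = \tr (V i *m V j).
    rewrite -!sl2_conjM !tr_sl2_conj; have := t2 i j.
    by rewrite /rep_char !gmulfM.
  by rewrite !tr_mul_upper ?tg ?th.
have [e|e] := diagonals_match dU dV sUV tUV.
  apply: (closure 1%g) => i; have [-> ->] := e i.
  by rewrite echi /sl2_conj /= mul1mx invmx1 mulmx1.
apply: (closure (SL2 weyl)) => i; have [-> ->] := e i.
rewrite echi -/(U i); set w := SL2 _.
apply: (can_inj (mulmxK (sl2_unit w))); rewrite /sl2_conj mulmxKV ?sl2_unit //.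
by move: (U i) => W; apply: mx2P; rewrite !mulmx2E /= !mx2E; ring.
Qed.

Lemma ordered_prod_of_sorted (s : seq 'I_n) : sorted ltn (map val s) ->
  exists j : 'I_(size s) -> 'I_n, increasing j /\
    ordered_prod gam j = (\prod_(i <- s) gam i)%g.
Proof.
move=> inc; exists (tnth (in_tuple s)); split=> [a b ab|].
  have x0 := tnth (in_tuple s) a.
  have := sorted_ltn_nth ltn_trans 0%N inc a b.
  rewrite !inE size_map => /(_ (ltn_ord a) (ltn_ord b) ab).
  by rewrite !(nth_map x0) // !(tnth_nth x0).
by rewrite /ordered_prod -(big_tuple _ _ (in_tuple s) predT gam).
Qed.

Lemma closure_equiv_of_triples rho sigma : generates gam ->
  agree_upto gam 3 rho sigma -> closure_equiv gam rho sigma.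
Proof.
move=> hgam agree.
have agr s : sorted ltn (map val s) -> (0 < size s <= 3)%N ->
    rep_char rho (\prod_(i <- s) gam i)%g =
    rep_char sigma (\prod_(i <- s) gam i)%g.
  move=> inc sz; have [j [incj <-]] := ordered_prod_of_sorted inc; exact: agree.
pose A i : 'M[F]_2 := rho (gam i); pose B i : 'M[F]_2 := sigma (gam i).
have d i : \det (A i) = \det (B i) by rewrite !det_sl2.
have t1 i : \tr (A i) = \tr (B i).
  by have := agr [:: i] isT isT; rewrite big_seq1.
have t2lt (i j : 'I_n) : (i < j)%N -> \tr (A i *m A j) = \tr (B i *m B j).
  move=> ij; have := agr [:: i; j]; rewrite /= ij => /(_ isT isT).
  by rewrite !big_cons big_nil mulg1 /rep_char !gmulfM.
have t2 i j : \tr (A i *m A j) = \tr (B i *m B j).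
  have [ij|ji|/val_inj ->] := ltngtP i j; first exact: t2lt.
    by rewrite mxtrace_mulC [RHS]mxtrace_mulC; apply: t2lt.
  by rewrite !tr_sq t1 d.
have t3 : forall i j k, \tr (A i *m A j *m A k) = \tr (B i *m B j *m B k).
  apply: triple_traces => // i j k /andP [ij jk].
  have := agr [:: i; j; k]; rewrite /= ij jk => /(_ isT isT).
  by rewrite !big_cons big_nil mulg1 /rep_char !gmulfM /= !mulmxA.
have [[g tg]|[g eg]] := conjugate_or_triangular d t1 t2 t3; last first.
  exists sigma; split; apply: mem_closure; last exact: conj_orbit_refl.
  exact: conj_orbit_gen hgam eg.
have [i|i|i j|i j k|[h th]|[h eh]] := @conjugate_or_triangular _ _ B A;
  [by []|by []|by []|by []| |].
  apply: closure_equiv_triangular hgam _ _ tg th => // i j.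
  by rewrite /rep_char !gmulfM; apply: t2.
exists rho; split; apply: mem_closure; first exact: conj_orbit_refl.
exact: conj_orbit_gen hgam eh.
Qed.

Lemma increasing_leq m (j : 'I_m -> 'I_n) : increasing j -> (m <= n)%N.
Proof.
move=> inc; have injj : injective j.
  move=> a b eab; apply/val_inj.
  by case: (ltngtP a b) => // ab; have := inc _ _ ab; rewrite eab ltnn.
by have := leq_card j injj; rewrite !card_ord.
Qed.
End Main.

Theorem corollary16 (F : closedFieldType) (G : groupType) (n : nat)
    (gam : 'I_n -> G) (hgam : generates gam) (rho sigma : 'Hom_SL2(G, F)) :
  [<-> forall x : G, rep_char rho x = rep_char sigma x;
       agree_upto gam n rho sigma;
       agree_upto gam 3 rho sigma;
       closure_equiv gam rho sigma].
Proof.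
tfae=> [chars m j _ _ | agree m j /andP [m0 _] inc | | [chi [clr cls]] x].
- exact: chars.
- by apply: agree => //; rewrite m0 (increasing_leq inc).
- exact: closure_equiv_of_triples hgam.
by rewrite -(char_closure x hgam clr) (char_closure x hgam cls).
Qed.
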